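(* Let $\mathsf{K}$ be a variety consisting of Gödel algebras, or a variety consisting of relative Stone algebras. Then every $\mathsf{K}$-epimorphism is surjective. In other words, all Gödel logics and all positive Gödel logics have the infinite Beth property.
   Context: A Brouwerian algebra is an algebra $\langle A;\to,\wedge,\vee,\top\rangle$ whose $\wedge,\vee$ reduct is a lattice with greatest element $\top$ and in which $x\wedge y\leqslant z\iff x\leqslant y\to z$. A Heyting algebra is a Brouwerian algebra with a distinguished least element $\bot$. A Gödel algebra is a subdirect product of totally ordered Heyting algebras; a relative Stone algebra is a subdirect product of totally ordered Brouwerian algebras. These form varieties $\mathsf{GA}$ and $\mathsf{RSA}$. A class $\mathsf{K}$ of similar algebras is regarded as a category whose morphisms are all algebraic homomorphisms between members of $\mathsf{K}$. A $\mathsf{K}$-morphism $h\colon A\to B$ is a $\mathsf{K}$-epimorphism if, for all $\mathsf{K}$-morphisms $f,g$ from $B$ to a single member of $\mathsf{K}$, $f\circ h=g\circ h$ implies $f=g$. The Gödel logics (resp. positive Gödel logics) are the logics algebraized by the subvarieties of $\mathsf{GA}$ (resp. of $\mathsf{RSA}$), i.e., the axiomatic extensions of intuitionistic propositional logic (resp. of its negation-less fragment, in the signature $\to,\wedge,\vee,\top$) having $(x\to y)\vee(y\to x)$ as a theorem. Write $\alpha\leftrightarrow\beta$ for $(\alpha\to\beta)\wedge(\beta\to\alpha)$. The infinite Beth property for a logic $\vdash$ says the following. Let $X$ and $Z$ be disjoint sets of variables (of arbitrary, possibly infinite cardinality, arbitrarily many variables being available) and $\Gamma$ a (possibly infinite)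 set of formulas over $X\cup Z$. Suppose that $\Gamma\cup\sigma[\Gamma]\vdash z\leftrightarrow\sigma(z)$ for all $z\in Z$ and all uniform substitutions $\sigma$ (of formulas for variables) such that $\sigma(x)=x$ for all $x\in X$, where the formulas in the range of $\sigma|_{X\cup Z}$ may involve arbitrarily many variables beyond $X\cup Z$. Then for each $z\in Z$ there is a formula $\varphi_z$ over $X$ only such that $\Gamma\vdash z\leftrightarrow\varphi_z$. (It is assumed that $X\neq\emptyset$ unless the signature has constant symbols.) For an algebraizable logic, the infinite Beth property is known to be equivalent to surjectivity of all epimorphisms in the algebraic counterpart. *)

(* Defs.v *)
From mathcomp Require Import all_boot.
From mathcomp Require Import classical_sets.

Set Implicit Arguments.
Unset Strict Implicit.
Unset Printing Implicit Defensive.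

Local Open Scope classical_set_scope.

(** Signatures: ->, /\, \/, T, to which [FullSig] adds the constant _|_. *)
Inductive signature := PositiveSig | FullSig.

Definition has_bot (s : signature) : bool := if s is FullSig then true else false.

(** The argument of [bot] makes the constant available in [FullSig] only. *)
Record algebra (s : signature) : Type := Algebra {
  carrier :> Type;
  imp : carrier -> carrier -> carrier;
  meet : carrier -> carrier -> carrier;
  join : carrier -> carrier -> carrier;
  top : carrier;
  bot : has_bot s -> carrier }.

Arguments top {s} a.
Arguments bot {s} a _.

Section UniversalAlgebra.
Variable s : signature.
Implicit Types A B C : algebra s.

Definition hom A B (f : A -> B) : Prop :=
  [/\ {morph f : x y / imp x y >-> imp x y},
      {morph f : x y / meet x y >-> meet x y},
      {morph f : x y / join x y >-> join x y},
      f (top A) = top B &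
      forall b : has_bot s, f (bot A b) = bot B b].

Definition surjective (T U : Type) (f : T -> U) : Prop :=
  forall y, exists x, f x = y.

Definition product (I : Type) (A : I -> algebra s) : algebra s :=
  @Algebra s (forall i, A i)
    (fun x y i => imp (x i) (y i)) (fun x y i => meet (x i) (y i))
    (fun x y i => join (x i) (y i)) (fun i => top (A i))
    (fun b i => bot (A i) b).

Definition subdirect_product (P : algebra s -> Prop) A : Prop :=
  exists (I : Type) (C : I -> algebra s) (e : A -> product C),
    [/\ forall i, P (C i), hom e, injective e &
        forall i, surjective (fun a => e a i)].

(** Closure under homomorphic images, (isomorphic copies of) subalgebras and
    direct products of arbitrary families. *)
Definition variety (K : algebra s -> Prop) : Prop :=
  [/\ forall A B (f : A -> B), K A -> hom f -> surjective f -> K B,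
      forall A B (f : B -> A), K A -> hom f -> injective f -> K B &
      forall (I : Type) (A : I -> algebra s), (forall i, K (A i)) -> K (product A)].

Definition epimorphism (K : algebra s -> Prop) A B (h : A -> B) : Prop :=
  [/\ K A, K B, hom h &
      forall C (f g : B -> C), K C -> hom f -> hom g ->
        f \o h =1 g \o h -> f =1 g].

Definition epimorphisms_surjective (K : algebra s -> Prop) : Prop :=
  forall A B (h : A -> B), epimorphism K h -> surjective h.

Definition le A (x y : A) : Prop := meet x y = x.

Definition totally_ordered A : Prop := forall x y : A, le x y \/ le y x.

Definition lattice A : Prop :=
  [/\ associative (@meet s A) /\ commutative (@meet s A),
      associative (@join s A) /\ commutative (@join s A),
      forall x y : A, meet x (join x y) = x &
      forall x y : A, join x (meet x y) = x].

(** In [FullSig] this only constrains the reduct without _|_. *)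
Definition brouwerian A : Prop :=
  [/\ lattice A,
      forall x : A, le x (top A) &
      forall x y z : A, le (meet x y) z <-> le x (imp y z)].

End UniversalAlgebra.

Definition heyting_algebra (A : algebra FullSig) : Prop :=
  brouwerian A /\ forall x : A, le (bot A isT) x.

Definition godel_algebra (A : algebra FullSig) : Prop :=
  subdirect_product (fun C => heyting_algebra C /\ totally_ordered C) A.

Definition relative_stone_algebra (A : algebra PositiveSig) : Prop :=
  subdirect_product (fun C => brouwerian C /\ totally_ordered C) A.

Inductive form (s : signature) (V : Type) : Type :=
| Var of V
| Imp of form s V & form s V
| And of form s V & form s V
| Or of form s V & form s V
| Top
| Bot of has_bot s.

Arguments Var {s V} _.
Arguments Top {s V}.
Arguments Bot {s V} _.

Definition Iff s V (a b : form s V) : form s V := And (Imp a b) (Imp b a).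

Fixpoint subst s V W (sigma : V -> form s W) (a : form s V) : form s W :=
  match a with
  | Var v => sigma v
  | Imp a b => Imp (subst sigma a) (subst sigma b)
  | And a b => And (subst sigma a) (subst sigma b)
  | Or a b => Or (subst sigma a) (subst sigma b)
  | Top => Top
  | Bot h => Bot h
  end.

Definition rename s V W (r : V -> W) : form s V -> form s W :=
  subst (fun v => Var (r v)).

(** A logic gives a consequence relation over every set [V] of variables. *)
Definition logic (s : signature) : Type :=
  forall V : Type, set (form s V) -> form s V -> Prop.

Inductive int_logic (V : Type) (Gamma : set (form FullSig V)) :
    form FullSig V -> Prop :=
| IntHyp a : Gamma a -> int_logic Gamma a
| IntMP a b : int_logic Gamma (Imp a b) -> int_logic Gamma a -> int_logic Gamma b
| IntK a b : int_logic Gamma (Imp a (Imp b a))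
| IntS a b c :
    int_logic Gamma (Imp (Imp a (Imp b c)) (Imp (Imp a b) (Imp a c)))
| IntAndL a b : int_logic Gamma (Imp (And a b) a)
| IntAndR a b : int_logic Gamma (Imp (And a b) b)
| IntAnd a b : int_logic Gamma (Imp a (Imp b (And a b)))
| IntOrL a b : int_logic Gamma (Imp a (Or a b))
| IntOrR a b : int_logic Gamma (Imp b (Or a b))
| IntOr a b c :
    int_logic Gamma (Imp (Imp a c) (Imp (Imp b c) (Imp (Or a b) c)))
| IntTop : int_logic Gamma Top
| IntBot a : int_logic Gamma (Imp (@Bot FullSig V isT) a).

Fixpoint embed V (a : form PositiveSig V) : form FullSig V :=
  match a with
  | Var v => Var v
  | Imp a b => Imp (embed a) (embed b)
  | And a b => And (embed a) (embed b)
  | Or a b => Or (embed a) (embed b)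
  | Top => Top
  | Bot _ => @Bot FullSig V isT (* vacuous case *)
  end.

(** The negation-less fragment of intuitionistic logic. *)
Definition pos_int_logic : logic PositiveSig :=
  fun V Gamma a => int_logic (@embed V @` Gamma) (embed a).

(** Formulas being finite, countably many variables suffice to write the axioms,
    all of whose substitution instances are added as premises. *)
Definition extend s (L : logic s) (Ax : set (form s nat)) : logic s :=
  fun V Gamma a =>
    L V (Gamma `|` [set b | exists (sigma : nat -> form s V) (c : form s nat),
                              Ax c /\ b = subst sigma c]) a.

Definition axiomatic_extension s (L L' : logic s) : Prop :=
  exists Ax : set (form s nat),
    forall V (Gamma : set (form s V)) a, L' V Gamma a <-> extend L Ax Gamma a.

Definition prelinearity s : form s nat :=
  Or (Imp (Var 0) (Var 1)) (Imp (Var 1) (Var 0)).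

Definition godel_logic (L : logic FullSig) : Prop :=
  axiomatic_extension int_logic L /\ L nat set0 (prelinearity FullSig).

Definition positive_godel_logic (L : logic PositiveSig) : Prop :=
  axiomatic_extension pos_int_logic L /\ L nat set0 (prelinearity PositiveSig).

(** Disjoint sets of variables are the summands of a sum type, [Y] being the
    variables beyond X and Z.  [X] may be empty, since T is a constant. *)
Definition infinite_beth s (L : logic s) : Prop :=
  forall (X Z : Type) (Gamma : set (form s (X + Z))),
  (forall (Y : Type) (sigma : X + Z + Y -> form s (X + Z + Y)),
     (forall x : X, sigma (inl (inl x)) = Var (inl (inl x))) ->
     let Gamma' : set (form s (X + Z + Y)) := rename inl @` Gamma in
     forall z : Z,
       L (X + Z + Y)%type (Gamma' `|` subst sigma @` Gamma')
         (Iff (Var (inl (inr z))) (sigma (inl (inr z))))) ->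
  forall z : Z, exists phi : form s X,
    L (X + Z)%type Gamma (Iff (Var (inr z)) (rename inl phi)).

(* Main.v *)
Require Import Defs.
From mathcomp Require Import all_boot.
From mathcomp Require Import boolp classical_sets.

(** Let [h : A -> B] be an epimorphism in a class [K] of prelinear Brouwerian
    algebras closed under quotients, and call a set of elements of an algebra a
    deductive filter if it contains the intuitionistic axioms and is closed
    under modus ponens.

    Chains have no proper epic subalgebras: if [d] is an element of a chain
    missed by a homomorphism into it, then sending to the top all elements
    above [d], once sparing [d] and once not, yields two endomorphisms that
    differ at [d] only ([chain_separation]). The quotient of [B] by a prime
    filter [F] is a chain in [K], so [A] maps onto it ([prime_quotient_onto]).

    Suppose that [b] is not in the image of [h]. The prime filter theorem gives
    a prime filter [F] containing [b] and no [h a] below [b], and then a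
    deductive filter [G] that omits [b] and contains every [h a] in [F]. The
    filter [E] generated by [F] and the [h a] in [G] has the same trace as [G]
    on the image of [h]; this is where implication is used: if [h c] in [G]
    and [h c -> h a] in [F], then [h (c -> a)] is in [F], hence in [G], and so
    is [h a]. Since [A] maps onto the quotients by [F] and by the larger [E],
    the quotient by [E] is a quotient of [A], and equality of traces embeds
    it in the quotient by [G]. This produces a homomorphism from [B] to the
    quotient by [G] that agrees with the projection on the image of [h]. As
    [h] is epic the two coincide, so [E] is contained in [G] ([equal_trace]),
    although [b] is in [E] and not in [G].

    For the logics, the formulas over X and Z modulo provability from Gamma
    form an algebra [B] in the class [K] of models of the logic, and formulas
    over X map to [B]. If two homomorphisms [f, g] from [B] to a model [C]
    agree on X, take the elements of [C] as additional variables and substitute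
    for each z the variable [g z]; under the valuation that reads z as [f z],
    the premises of implicit definability hold in [C], whence [f z = g z]. So
    the map is epic, hence onto, and a formula over X in the class of z defines
    z. For the negation-less fragment, soundness in Brouwerian algebras follows
    by adding a new least element to them ([some_in_deductive]). *)

Set Implicit Arguments.
Unset Strict Implicit.
Unset Printing Implicit Defensive.

Local Open Scope classical_set_scope.

(** * Deductive filters and their quotients *)

(** Implication, conjunction and disjunction are governed by the Hilbert axioms
    alone, in an arbitrary algebra. The notion thus covers at once the filters
    of Brouwerian algebras and, in the algebra of formulas, the sets of
    consequences of a set of premises. *)
Record deductive s (A : algebra s) (D : A -> Prop) : Prop := Deductive {
  ded_mp : forall x y, D (imp x y) -> D x -> D y;
  ded_K : forall x y, D (imp x (imp y x));
  ded_S : forall x y z,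
    D (imp (imp x (imp y z)) (imp (imp x y) (imp x z)));
  ded_meetl : forall x y, D (imp (meet x y) x);
  ded_meetr : forall x y, D (imp (meet x y) y);
  ded_meet : forall x y, D (imp x (imp y (meet x y)));
  ded_joinl : forall x y, D (imp x (join x y));
  ded_joinr : forall x y, D (imp y (join x y));
  ded_join : forall x y z,
    D (imp (imp x z) (imp (imp y z) (imp (join x y) z)));
  ded_top : D (top A);
  ded_bot : forall (b : has_bot s) x, D (imp (bot A b) x) }.

Definition bounded_brouwerian s (A : algebra s) : Prop :=
  brouwerian A /\ forall (b : has_bot s) (x : A), le (bot A b) x.

Section Entailment.
Variables (s : signature) (A : algebra s) (D : A -> Prop) (dD : deductive D).
Implicit Types x y z : A.

Lemma ent_weak x y : D x -> D (imp y x).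
Proof. exact: ded_mp (ded_K dD _ _). Qed.

Lemma ent_mp z x y : D (imp z (imp x y)) -> D (imp z x) -> D (imp z y).
Proof. by move=> zxy; apply: (ded_mp dD); apply: (ded_mp dD) zxy; exact: ded_S. Qed.

Lemma ent_refl x : D (imp x x).
Proof. exact: ent_mp (ded_K dD x (imp x x)) (ded_K dD _ _). Qed.

Lemma ent_trans y x z : D (imp x y) -> D (imp y z) -> D (imp x z).
Proof. by move=> xy yz; apply: ent_mp xy; apply: ent_weak. Qed.

Lemma ent_meet z x y : D (imp z x) -> D (imp z y) -> D (imp z (meet x y)).
Proof. by move=> zx; apply: ent_mp; apply: ent_trans zx (ded_meet dD _ _). Qed.

Lemma ent_join x y z : D (imp x z) -> D (imp y z) -> D (imp (join x y) z).
Proof.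
by move=> xz yz; apply: (ded_mp dD) yz; apply: (ded_mp dD) xz; exact: ded_join.
Qed.

(** The deduction theorem for conjunction: it becomes residuation in quotients. *)
Lemma ent_residual x y z : D (imp (meet x y) z) <-> D (imp x (imp y z)).
Proof.
split=> [xyz|xyz].
  apply: ent_trans (ded_meet dD x y) _.
  by apply: (ded_mp dD) (ent_weak y xyz); exact: ded_S.
by apply: (ent_mp (x := y)) (ded_meetr dD _ _); apply: ent_trans (ded_meetl dD _ _) xyz.
Qed.

Lemma meet_mem x y : D x -> D y -> D (meet x y).
Proof. by move=> Dx; apply: (ded_mp dD); apply: (ded_mp dD) Dx; exact: ded_meet. Qed.

(** The axioms pass upwards, so a larger set needs only modus ponens. *)
Lemma deductive_superset (E : A -> Prop) :
  (forall x, D x -> E x) -> (forall x y, E (imp x y) -> E x -> E y) ->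
  deductive E.
Proof.
move=> DE mpE; split=> // *; apply: DE.
- exact: ded_K.
- exact: ded_S.
- exact: ded_meetl.
- exact: ded_meetr.
- exact: ded_meet.
- exact: ded_joinl.
- exact: ded_joinr.
- exact: ded_join.
- exact: ded_top.
- exact: ded_bot.
Qed.

(** Leibniz equality of the predicates [equiv D x] serves as equality of
    classes in the quotient. *)
Definition equiv x y := D (imp x y) /\ D (imp y x).

Lemma equiv_refl x : equiv x x.
Proof. by split; exact: ent_refl. Qed.

Lemma equiv_sym x y : equiv x y -> equiv y x.
Proof. by case. Qed.

Lemma equiv_trans y x z : equiv x y -> equiv y z -> equiv x z.
Proof. by move=> [xy yx] [yz zy]; split; [apply: ent_trans yz|apply: ent_trans yx]. Qed.

Lemma ent_imp x x' y y' :
  D (imp x' x) -> D (imp y y') -> D (imp (imp x y) (imp x' y')).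
Proof.
move=> xx yy; apply/ent_residual; apply: ent_trans yy.
apply: ent_mp (ded_meetl dD _ _) _.
exact: ent_trans (ded_meetr dD _ _) xx.
Qed.

Lemma ent_meet2 x x' y y' :
  D (imp x x') -> D (imp y y') -> D (imp (meet x y) (meet x' y')).
Proof.
move=> xx yy; apply: ent_meet.
  exact: ent_trans (ded_meetl dD _ _) xx.
exact: ent_trans (ded_meetr dD _ _) yy.
Qed.

Lemma ent_join2 x x' y y' :
  D (imp x x') -> D (imp y y') -> D (imp (join x y) (join x' y')).
Proof.
move=> xx yy; apply: ent_join.
  exact: ent_trans xx (ded_joinl dD _ _).
exact: ent_trans yy (ded_joinr dD _ _).
Qed.

End Entailment.

Section Quotient.
Variables (s : signature) (A : algebra s) (D : A -> Prop).

Definition quotient_carrier := {S : A -> Prop | exists x, S = equiv D x}.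

Definition class (x : A) : quotient_carrier :=
  exist _ (equiv D x) (ex_intro _ x erefl).

Definition repr (q : quotient_carrier) : A := sval (cid (svalP q)).

Lemma class_repr q : class (repr q) = q.
Proof.
rewrite /repr; case: cid => x /= qx; case: q qx => S eS /= Sx.
exact: eq_exist.
Qed.

Definition quotient : algebra s :=
  @Algebra s quotient_carrier
    (fun p q => class (imp (repr p) (repr q)))
    (fun p q => class (meet (repr p) (repr q)))
    (fun p q => class (join (repr p) (repr q)))
    (class (top A)) (fun b => class (bot A b)).

Definition proj (x : A) : quotient := class x.

Lemma proj_surjective : surjective proj.
Proof. by move=> q; exists (repr q); exact: class_repr. Qed.

Hypothesis dD : deductive D.

Lemma proj_eq x y : proj x = proj y <-> equiv D x y.
Proof.
split=> [[eqxy]|xy]; first by rewrite eqxy; exact: equiv_refl.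
apply: eq_exist; apply/predeqP => z; split; apply: equiv_trans => //.
exact: equiv_sym.
Qed.

Lemma repr_proj x : equiv D (repr (proj x)) x.
Proof. by apply/proj_eq; exact: class_repr. Qed.

Lemma proj_hom : hom proj.
Proof.
split=> // x y; apply/proj_eq;
  have [xr rx] := repr_proj x; have [yr ry] := repr_proj y.
- by split; exact: ent_imp.
- by split; exact: ent_meet2.
- by split; exact: ent_join2.
Qed.

Lemma proj_top x : proj x = top quotient <-> D x.
Proof.
split=> [/proj_eq[_ tx]|Dx]; first by apply: (ded_mp dD) tx _; exact: ded_top.
by apply/proj_eq; split; apply: ent_weak => //; exact: ded_top.
Qed.

Lemma proj_le x y : le (proj x) (proj y) <-> D (imp x y).
Proof.
have [_ pm _ _ _] := proj_hom; rewrite /le -pm.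
split=> [/proj_eq[_ xm]|xy].
  by apply: ent_trans xm _ => //; exact: ded_meetr.
apply/proj_eq; split; first exact: ded_meetl.
by apply: ent_meet => //; exact: ent_refl.
Qed.

(** The Lindenbaum-Tarski construction: entailment modulo [D] has the universal
    properties of meets, joins, implication and bounds by the axioms. *)
Lemma quotient_brouwerian : bounded_brouwerian quotient.
Proof.
have [pi pm pj pt pb] := proj_hom.
have pP P : (forall x, P (proj x)) -> forall q, P q.
  by move=> Px q; rewrite -[q]class_repr; exact: Px.
have rf := ent_refl dD; have tr := @ent_trans _ _ _ dD.
have mtl := ded_meetl dD; have mtr := ded_meetr dD.
have mt := @ent_meet _ _ _ dD.
have jnl := ded_joinl dD; have jnr := ded_joinr dD.
have jn := @ent_join _ _ _ dD.
split; last by move=> b; elim/pP => x; apply/proj_le; exact: ded_bot.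
split; [split; first split|..].
- move=> p q r; elim/pP: p => x; elim/pP: q => y; elim/pP: r => z.
  rewrite -!pm; apply/proj_eq; split.
    by do 2?apply: (mt); rewrite //; apply: (tr _ _ _ (mtr _ _)).
  by do 2?apply: (mt); rewrite //; apply: (tr _ _ _ (mtl _ _)).
- move=> p q; elim/pP: p => x; elim/pP: q => y.
  by rewrite -!pm; apply/proj_eq; split; apply: (mt).
- split=> [p q r|p q].
    elim/pP: p => x; elim/pP: q => y; elim/pP: r => z.
    rewrite -!pj; apply/proj_eq; split.
      by do 2?apply: (jn); rewrite //; apply: (tr _ _ _ _ (jnl _ _)).
    by do 2?apply: (jn); rewrite //; apply: (tr _ _ _ _ (jnr _ _)).
  elim/pP: p => x; elim/pP: q => y.
  by rewrite -!pj; apply/proj_eq; split; apply: (jn).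
- elim/pP => x; elim/pP => y.
  by rewrite -pj -pm; apply/proj_eq; split => //; apply: (mt).
- elim/pP => x; elim/pP => y.
  by rewrite -pm -pj; apply/proj_eq; split => //; apply: (jn).
- by elim/pP => x; apply/proj_le; apply: ent_weak => //; exact: ded_top.
- elim/pP => x; elim/pP => y; elim/pP => z.
  by rewrite -pm -pi !proj_le; exact: ent_residual.
Qed.

End Quotient.

Section Order.
Variables (s : signature) (A : algebra s) (bA : bounded_brouwerian A).
Implicit Types x y z : A.

Let lA : lattice A := let: conj (And3 l _ _) _ := bA in l.
Let residual x y z : le (meet x y) z <-> le x (imp y z) :=
  let: conj (And3 _ _ r) _ := bA in r x y z.

Lemma meetC : commutative (@meet s A). Proof. by case: lA => [[]]. Qed.
Lemma meetA : associative (@meet s A). Proof. by case: lA => [[]]. Qed.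
Lemma joinC : commutative (@join s A). Proof. by case: lA => _ []. Qed.
Lemma meetK x y : meet x (join x y) = x. Proof. by case: lA. Qed.
Lemma joinK x y : join x (meet x y) = x. Proof. by case: lA. Qed.
Lemma meetxx x : meet x x = x.
Proof. by rewrite -{2}(joinK x x) meetK. Qed.
Lemma le_refl x : le x x. Proof. exact: meetxx. Qed.
Lemma le_top x : le x (top A). Proof. by case: bA => [[]]. Qed.
Lemma le_trans y x z : le x y -> le y z -> le x z.
Proof. by rewrite /le => xy yz; rewrite -xy -meetA yz. Qed.
Lemma le_anti x y : le x y -> le y x -> x = y.
Proof. by rewrite /le meetC => -> . Qed.
Lemma le_meetl x y : le (meet x y) x.
Proof. by rewrite /le meetC meetA meetxx. Qed.
Lemma le_meetr x y : le (meet x y) y. Proof. by rewrite meetC; exact: le_meetl. Qed.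
Lemma le_meet z x y : le z x -> le z y -> le z (meet x y).
Proof. by rewrite /le => zx zy; rewrite meetA zx. Qed.
Lemma le_joinE x y : le x y <-> join x y = y.
Proof.
split=> [xy|<-]; last exact: meetK.
by rewrite -xy joinC meetC joinK.
Qed.
Lemma le_joinl x y : le x (join x y). Proof. exact: meetK. Qed.
Lemma le_joinr x y : le y (join x y). Proof. by rewrite joinC; exact: le_joinl. Qed.
Lemma le_join x y z : le x z -> le y z -> le (join x y) z.
Proof.
move=> /le_joinE xz /le_joinE yz; apply/le_joinE.
have [_ [jA _] _ _] := lA.
by rewrite -jA yz.
Qed.

Lemma imp_topE x y : imp x y = top A <-> le x y.
Proof.
have tE : le (meet (top A) x) y <-> le x y.
  by rewrite meetC (le_top x).
rewrite -tE residual; split=> [->|]; first exact: le_refl.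
by apply: le_anti; exact: le_top.
Qed.

(** Validity of the axioms in Brouwerian algebras. It makes the calculus of
    entailment available for the order itself. *)
Lemma deductive_top : deductive (fun x : A => x = top A).
Proof.
have mp z x y : le z (imp x y) -> le z x -> le z y.
  by move=> /residual xyz zx; apply: le_trans xyz; apply: le_meet => //; exact: le_refl.
have ml := le_meetl; have mr := le_meetr; have tr := le_trans.
split.
- move=> x y + xt; rewrite xt imp_topE => ty.
  by apply: le_anti ty; exact: le_top.
- by move=> x y; apply/imp_topE/residual.
- move=> x y z; apply/imp_topE; rewrite -!residual.
  set w := meet _ x; have wx : le w x := mr _ _.
  apply: (mp _ y); apply: (mp _ x _ _ wx); apply: tr (ml _ _) _; [exact: ml|exact: mr].
- by move=> x y; apply/imp_topE.
- by move=> x y; apply/imp_topE.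
- by move=> x y; apply/imp_topE/residual; exact: le_refl.
- by move=> x y; apply/imp_topE; exact: le_joinl.
- by move=> x y; apply/imp_topE; exact: le_joinr.
- move=> x y z; apply/imp_topE; rewrite -!residual.
  rewrite meetC residual; apply: le_join; rewrite -residual meetC.
    by apply: (mp _ x) => //; apply: tr (ml _ _) _; exact: ml.
  by apply: (mp _ y) => //; apply: tr (ml _ _) _; exact: mr.
- by [].
- by move=> b x; apply/imp_topE; case: bA.
Qed.

End Order.

(** * Prime filters *)

Definition prime_set s (A : algebra s) (D : A -> Prop) : Prop :=
  forall x y, D (join x y) -> D x \/ D y.

(** The filter generated by [D] and [x], by the deduction theorem. *)
Lemma adjoin_deductive s (A : algebra s) (D : A -> Prop) (x : A) :
  deductive D -> deductive (fun z => D (imp x z)).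
Proof.
move=> dD; apply: (deductive_superset dD) => [z|y z]; first exact: ent_weak.
exact: ent_mp.
Qed.

(** Keeping [D] as a summand makes the empty chain harmless. *)
Lemma bigcup_deductive s (A : algebra s) (D : A -> Prop) (F : set (set A)) :
  deductive D -> total_on F subset ->
  (forall X, F X -> deductive (D `|` X)) ->
  deductive (D `|` \bigcup_(X in F) X).
Proof.
move=> dD totF dF; set U := _ `|` _.
apply: (deductive_superset dD) => [x Dx|x y]; first by left.
have mono X : F X -> D `|` X `<=` U.
  by move=> FX z [Dz|Xz]; [left|right; exists X].
have mp X : F X -> (D `|` X) (imp x y) -> (D `|` X) x -> U y.
  by move=> FX Xxy Xx; apply: (mono X) => //; apply: ded_mp Xxy Xx; exact: dF.
move=> [Dxy|[X FX Xxy]] [Dx|[Y FY Yx]].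
- by left; exact: ded_mp Dxy Dx.
- by apply: (mp Y) => //; [left|right].
- by apply: (mp X) => //; [right|left].
- have [XY|YX] := totF _ _ FX FY.
    by apply: (mp Y) => //; right => //; exact: XY.
  by apply: (mp X) => //; right => //; exact: YX.
Qed.

(** The prime filter theorem. [I] may be empty, and the resulting filter
    improper: the quotient is then a one-element chain. Primeness follows from
    maximality: if neither [x] nor [y] is in [F], both entail elements of [I]
    modulo [F], so [join x y] entails an element of [I] and is not in [F]. *)
Lemma exists_prime_filter s (A : algebra s) (D I : A -> Prop) :
  deductive D -> (forall x y, I x -> I y -> I (join x y)) ->
  (forall x, D x -> ~ I x) ->
  exists F : A -> Prop,
    [/\ deductive F, prime_set F, forall x, D x -> F x & forall x, F x -> ~ I x].
Proof.
move=> dD Ij DI.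
pose P (X : set A) := deductive (D `|` X) /\ forall x, X x -> ~ I x.
have [|M [[dM MI] maxM]] := @Zorn_bigcup A P.
  move=> F FP totF; split.
    by apply: bigcup_deductive => // X /FP[].
  by move=> x [X /FP[_]]; apply.
have FI x : (D `|` M) x -> ~ I x by case=> [/DI|/MI].
exists (D `|` M); split=> //; last by left.
have meetsI x : ~ (D `|` M) x -> exists2 i, I i & (D `|` M) (imp x i).
  move=> Mx; apply: contrapT => noI.
  pose N : set A := fun z => (D `|` M) (imp x z).
  have subN z : (D `|` M) z -> N z by move=> Mz; exact: ent_weak.
  apply: (maxM N).
    split=> [z Mz|NM]; first by apply: subN; right.
    by apply: Mx; right; apply: NM; exact: ent_refl.
  split; last by move=> i Ni Ii; apply: noI; exists i.
  suff -> : D `|` N = N by exact: adjoin_deductive.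
  by apply/setUidPr => z Dz; apply: subN; left.
move=> x y Mxy; apply: contrapT => /not_orP[/meetsI[i Ii xi] /meetsI[j Ij' yj]].
apply: (FI (join i j)); last exact: Ij.
apply: (ded_mp dM) Mxy; apply: ent_join => //.
  by apply: ent_trans xi _ => //; exact: ded_joinl.
by apply: ent_trans yj _ => //; exact: ded_joinr.
Qed.

(** The filter generated by [E] and the trace of [G] on the image of [h]. *)
Definition extension s (A B : algebra s) (h : A -> B) (G E : B -> Prop) (x : B) : Prop :=
  exists a : A, G (h a) /\ E (imp (h a) x).

Lemma extension_subr s (A B : algebra s) (h : A -> B) (G E : B -> Prop) x :
  hom h -> deductive G -> deductive E -> E x -> extension h G E x.
Proof.
move=> [_ _ _ ht _] dG dE Ex; exists (top A); rewrite ht.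
by split; [exact: ded_top|exact: ent_weak].
Qed.

Lemma extension_deductive s (A B : algebra s) (h : A -> B) (G E : B -> Prop) :
  hom h -> deductive G -> deductive E -> deductive (extension h G E).
Proof.
move=> hom_h dG dE; have [_ hm _ _ _] := hom_h.
apply: (deductive_superset dE) => [x|x y]; first exact: extension_subr.
move=> [a [Ga ax]] [c [Gc cx]]; exists (meet a c); rewrite hm.
split; first exact: meet_mem.
apply: (ent_mp dE (x := x)).
  exact: (ent_trans dE) (ded_meetl dE _ _) ax.
exact: (ent_trans dE) (ded_meetr dE _ _) cx.
Qed.

Lemma extension_subl s (A B : algebra s) (h : A -> B) (G E : B -> Prop) a :
  deductive E -> G (h a) -> extension h G E (h a).
Proof. by move=> dE Ga; exists a; split=> //; exact: ent_refl. Qed.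

(** Implication keeps the trace from growing: the entailment [h c -> h a] that
    puts [h a] in the extension is itself in the image of [h]. *)
Lemma extension_trace s (A B : algebra s) (h : A -> B) (G E : B -> Prop) a :
  hom h -> deductive G -> (forall c, E (h c) -> G (h c)) ->
  extension h G E (h a) -> G (h a).
Proof.
move=> [hi _ _ _ _] dG EG [c [Gc]]; rewrite -hi => /EG; rewrite hi => Gca.
exact: ded_mp Gca Gc.
Qed.

(** * Chains *)

Definition prelinear_brouwerian s (A : algebra s) : Prop :=
  bounded_brouwerian A /\ forall x y : A, join (imp x y) (imp y x) = top A.

(** A prime filter contains a disjunct of each instance of prelinearity. *)
Lemma quotient_prime_total s (A : algebra s) (F : A -> Prop) :
  prelinear_brouwerian A -> deductive F -> prime_set F ->
  totally_ordered (quotient F).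
Proof.
move=> [_ pl] dF pF p q; rewrite -[p]class_repr -[q]class_repr.
have /pF[/proj_le-/(_ dF)|/proj_le-/(_ dF)] :
    F (join (imp (repr p) (repr q)) (imp (repr q) (repr p))).
  by rewrite pl; exact: ded_top.
- by left.
- by right.
Qed.

Section Chain.
Variables (s : signature) (C : algebra s).
Hypotheses (bC : bounded_brouwerian C) (totC : totally_ordered C).
Implicit Types x y : C.

Lemma chain_imp x y : ~ le x y -> imp x y = y.
Proof.
have [[_ _ res] _] := bC.
move=> xy; apply: (le_anti bC); last by apply/res; exact: le_meetl.
have := le_refl bC (imp x y); move=> /res ixy.
have [xi|ix] := totC x (imp x y); last by rewrite /le in ix; rewrite ix in ixy.
by case: xy; move: ixy; rewrite (meetC bC) xi.
Qed.

Definition collapse (U : C -> Prop) x : C := if pselect (U x) then top C else x.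

Lemma collapse_in (U : C -> Prop) x : U x -> collapse U x = top C.
Proof. by rewrite /collapse; case: pselect. Qed.

Lemma collapse_out (U : C -> Prop) x : ~ U x -> collapse U x = x.
Proof. by rewrite /collapse; case: pselect. Qed.

(** In a chain [imp x y] is the top or [y], which any map that is monotone and
    either fixes its argument or sends it to the top respects. *)
Lemma collapse_hom (U : C -> Prop) :
  (forall x y, le x y -> U x -> U y) -> (forall b, ~ U (bot C b)) ->
  hom (collapse U).
Proof.
move=> upU Ubot.
have ctop : collapse U (top C) = top C by rewrite /collapse; case: pselect.
have cmono x y : le x y -> le (collapse U x) (collapse U y).
  move=> xy; have [Ux|Ux] := pselect (U x).
    by rewrite !collapse_in //; [exact: le_refl|exact: upU Ux].
  rewrite (collapse_out Ux); have [Uy|Uy] := pselect (U y).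
    by rewrite collapse_in //; exact: le_top.
  by rewrite collapse_out.
split=> //.
- move=> x y; have [xy|xy] := pselect (le x y).
    have /(imp_topE bC) -> := xy.
    by rewrite ctop; apply/esym/imp_topE => //; exact: cmono.
  rewrite (chain_imp xy); have [Uy|Uy] := pselect (U y).
    rewrite (collapse_in Uy); apply/esym/imp_topE => //; exact: le_top.
  rewrite (collapse_out Uy) chain_imp //.
  have [Ux|Ux] := pselect (U x); last by rewrite collapse_out.
  rewrite collapse_in // => ty; apply: xy.
  by apply: (le_trans bC) ty; exact: le_top.
- have cm x y : le x y -> collapse U (meet x y) = meet (collapse U x) (collapse U y).
    by move=> xy; rewrite (cmono _ _ xy) [meet x y]xy.
  move=> x y; have [|yx] := totC x y; first exact: cm.
  by rewrite (meetC bC x) (meetC bC (collapse U x)) cm.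
- have cj x y : le x y -> collapse U (join x y) = join (collapse U x) (collapse U y).
    by move=> xy; have /(le_joinE bC) -> := cmono _ _ xy; have /(le_joinE bC) -> := xy.
  move=> x y; have [|yx] := totC x y; first exact: cj.
  by rewrite (joinC bC x) (joinC bC (collapse U x)) cj.
- by move=> b; rewrite collapse_out.
Qed.

(** The elements strictly above [d], and those above [d] in the weak sense, are
    two upward closed sets whose collapses differ at [d] only. *)
Lemma chain_separation d :
  d <> top C -> (forall b, d <> bot C b) ->
  exists f g : C -> C,
    [/\ hom f, hom g, forall x, x <> d -> f x = g x & f d <> g d].
Proof.
move=> dt db.
have le_d x : x <> d -> le x d \/ le d x -> ~ le x d <-> le d x.
  move=> xd tot; split; first by case: tot.
  by move=> dx xd'; apply: xd; exact: (le_anti bC).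
have ltd b : le (bot C b) d by case: bC.
exists (collapse (fun x => ~ le x d)), (collapse (fun x => le d x)); split.
- apply: collapse_hom => [x y xy xd yd|b]; last by apply; exact: ltd.
  by apply: xd; exact: (le_trans bC) xy yd.
- apply: collapse_hom => [x y xy dx|b dbot]; first exact: (le_trans bC) dx xy.
  by apply: (db b); exact: (le_anti bC).
- move=> x xd; have [xdx dxx] := le_d x xd (totC _ _).
  have [dx|dx] := pselect (le d x); first by rewrite !collapse_in //; exact: dxx.
  by rewrite !collapse_out // => /xdx.
- rewrite collapse_out; last by apply; exact: le_refl.
  by rewrite collapse_in //; exact: le_refl.
Qed.

End Chain.

(** * Epimorphisms are surjective *)

Lemma hom_comp s (A B C : algebra s) (f : B -> C) (g : A -> B) :
  hom f -> hom g -> hom (f \o g).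
Proof.
move=> [fi fm fj ft fb] [gi gm gj gt gb].
by split=> [x y|x y|x y||b] /=; rewrite ?gi ?gm ?gj ?gt ?gb.
Qed.

Section Surjectivity.
Variables (s : signature) (K : algebra s -> Prop).
Hypothesis K_prelinear : forall A, K A -> prelinear_brouwerian A.
Hypothesis K_quotient : forall (A : algebra s) (D : A -> Prop),
  K A -> deductive D -> K (quotient D).
Variables (A B : algebra s) (h : A -> B).
Hypotheses (KB : K B) (hom_h : hom h).
Hypothesis h_epi : forall (C : algebra s) (f g : B -> C),
  K C -> hom f -> hom g -> f \o h =1 g \o h -> f =1 g.

(** A missed class [d] of the chain [quotient F] is neither its top nor its
    bottom, which [h] reaches, so [chain_separation] contradicts epicity. *)
Lemma prime_quotient_onto (F : B -> Prop) (b : B) :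
  deductive F -> prime_set F -> exists a, equiv F (h a) b.
Proof.
move=> dF pF; apply: contrapT => noa.
pose d := proj F b.
have dP a : proj F (h a) <> d by move=> /proj_eq e; apply: noa; exists a; exact: e.
have [[_ _ _ pt pb] [_ _ _ ht hb]] := (proj_hom dF, hom_h).
have [||||f [g [homf homg fg]]] := @chain_separation _ (quotient F) _ _ d.
- exact: quotient_brouwerian.
- by apply: quotient_prime_total => //; exact: K_prelinear.
- by rewrite -pt -ht => /esym; exact: dP.
- by move=> c; rewrite -pb -hb => /esym; exact: dP.
apply; apply: (h_epi (f := f \o proj F) (g := g \o proj F)).
- exact: K_quotient.
- by apply: hom_comp => //; exact: proj_hom.
- by apply: hom_comp => //; exact: proj_hom.
- by move=> a /=; apply: fg.
Qed.

(** Sending [b] to the class modulo [G] of some [h a] equivalent to [b] modulo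
    [F] does not depend on [a], as the traces agree. It is a homomorphism that
    coincides with the projection on the image of [h], hence everywhere. *)
Lemma equal_trace (F G : B -> Prop) :
  deductive F -> deductive G ->
  (forall b, exists a, equiv F (h a) b) ->
  (forall a, F (h a) <-> G (h a)) ->
  forall b, F b -> G b.
Proof.
move=> dF dG onto FG.
have [k kP] := choice onto.
have [[pi pm pj pt pb] [qi qm qj qt qb]] := (proj_hom dF, proj_hom dG).
have [hi hm hj ht hb] := hom_h.
(* The quotients by [F] and [G] identify the same elements of the image. *)
have transfer a c : proj F (h a) = proj F (h c) -> proj G (h a) = proj G (h c).
  move=> /(proj_eq dF)[ac ca]; apply/proj_eq => //.
  by split; rewrite -hi; apply/FG; rewrite hi.
have kF x : proj F (h (k x)) = proj F x by exact/proj_eq.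
have e : (fun b => proj G (h (k b))) =1 proj G.
  apply: h_epi; [exact: K_quotient| |exact: proj_hom|].
    split=> [x y|x y|x y||b].
    - by rewrite -qi -hi; apply: transfer; rewrite kF hi !pi !kF.
    - by rewrite -qm -hm; apply: transfer; rewrite kF hm !pm !kF.
    - by rewrite -qj -hj; apply: transfer; rewrite kF hj !pj !kF.
    - by rewrite -qt -ht; apply: transfer; rewrite kF.
    - by rewrite -qb -hb; apply: transfer; rewrite kF.
  by move=> a /=; apply: transfer; rewrite kF.
move=> b /(proj_top dF) Fb; apply/(proj_top dG); rewrite -e -qt -ht.
by apply: transfer; rewrite kF Fb ht pt.
Qed.

Theorem epi_surjective : surjective h.
Proof.
move=> b; apply: contrapT => bh.
have [bB _] := K_prelinear KB.
have [hi hm hj ht hb] := hom_h.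
have dT := deductive_top bB.
(* [F] contains [b] and no element of the image below [b]. *)
have [|x y [a [<- ab]] [c [<- cb]]|_ /[swap] -[a [<- ab]] /(imp_topE bB) ba|
    F [dF pF bF Fb]] := exists_prime_filter (D := fun x => imp b x = top B)
    (I := fun x => exists a, h a = x /\ le x b).
- exact: adjoin_deductive dT.
- by exists (join a c); split; [|exact: le_join].
- by apply: bh; exists a; exact: (le_anti bB).
(* [G] contains the trace of [F] and omits [b]. *)
pose T : B -> Prop := fun x => x = top B.
have [|_ _ -> ->|_ /[swap] -> [a [Fa /(imp_topE bB) ab]]|G [dG _ extG Gb]] :=
    exists_prime_filter (D := extension h F T) (I := fun x => x = b).
- exact: extension_deductive.
- by apply/le_joinE => //; exact: le_refl.
- by apply: (Fb (h a)) => //; exists a.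
have FG a : F (h a) -> G (h a).
  by move=> Fa; apply: extG; exact: extension_subl.
apply: (Gb b) => //.
(* Enlarging [F] by the trace of [G] equalises the traces and keeps [b]. *)
have dE := extension_deductive hom_h dG dF.
have sub x : F x -> extension h G F x by exact: extension_subr.
apply: (equal_trace dE dG) => [x|a|].
- have [a [ax xa]] := prime_quotient_onto x dF pF.
  by exists a; split; exact: sub.
- by split; [exact: extension_trace|exact: extension_subl].
- by apply: sub; apply: bF; apply/imp_topE => //; exact: le_refl.
Qed.

End Surjectivity.

Lemma subdirect_prelinear s (A : algebra s) :
  subdirect_product (fun C => bounded_brouwerian C /\ totally_ordered C) A ->
  prelinear_brouwerian A.
Proof.
move=> [I [C [e [bC [ei em ej et eb] inj_e _]]]].
have bCi i := (bC i).1.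
have eP x y : (forall i, e x i = e y i) -> x = y.
  by move=> exy; apply: inj_e; apply: functional_extensionality_dep.
have ei' x y i : e (imp x y) i = imp (e x i) (e y i) by rewrite ei.
have em' x y i : e (meet x y) i = meet (e x i) (e y i) by rewrite em.
have ej' x y i : e (join x y) i = join (e x i) (e y i) by rewrite ej.
have et' i : e (top A) i = top (C i) by rewrite et.
have leP x y : le x y <-> forall i, le (e x i) (e y i).
  split=> [xy i|xy]; first by rewrite /le -em' xy.
  by apply: eP => i; rewrite em' xy.
have bCi' i := (bCi i).1.
split; first (split; first split; first split; first split).
- by move=> x y z; apply: eP => i; rewrite !em' meetA.
- by move=> x y; apply: eP => i; rewrite !em' meetC.
- split=> [x y z|x y]; apply: eP => i; rewrite !ej'; last by rewrite joinC.
  by have [[_ [jA _] _ _] _ _] := bCi' i; rewrite jA.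
- by move=> x y; apply: eP => i; rewrite em' ej' meetK.
- by move=> x y; apply: eP => i; rewrite ej' em' joinK.
- by move=> x; apply/leP => i; rewrite et'; exact: le_top.
- move=> x y z; split=> /leP h; apply/leP => i; have [_ _ r] := bCi' i.
    by rewrite ei'; apply/r; rewrite -em'; exact: h.
  by rewrite em'; apply/r; rewrite -ei'; exact: h.
- by move=> b x; apply/leP => i; rewrite eb; exact: (bCi i).2.
- move=> x y; apply: eP => i; rewrite ej' !ei' et'.
  apply: (le_anti (bCi i)); first exact: le_top.
  case: (bC i) => _ /(_ (e x i) (e y i))[] /(imp_topE (bCi i)) ->.
    exact: le_joinl.
  exact: le_joinr.
Qed.

Lemma variety_epimorphisms_surjective s (K : algebra s -> Prop) :
  variety K -> (forall A, K A -> prelinear_brouwerian A) ->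
  epimorphisms_surjective K.
Proof.
move=> [HK _ _] Kpl A B h [_ KB hom_h h_epi].
apply: (epi_surjective Kpl) KB hom_h h_epi => C D KC dD.
by apply: HK (proj_hom dD) (@proj_surjective _ _ _).
Qed.

(** * Logics and their models *)

Section Formulas.
Variable s : signature.

Definition form_algebra (V : Type) : algebra s :=
  @Algebra s (form s V) (@Imp s V) (@And s V) (@Or s V) Top Bot.

Fixpoint eval (A : algebra s) V (v : V -> A) (a : form s V) : A :=
  match a with
  | Var x => v x
  | Imp a b => imp (eval v a) (eval v b)
  | And a b => meet (eval v a) (eval v b)
  | Or a b => join (eval v a) (eval v b)
  | Top => top A
  | Bot b => bot A b
  end.

Lemma eval_hom (A B : algebra s) (f : A -> B) V (v : V -> A) a :
  hom f -> f (eval v a) = eval (f \o v) a.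
Proof.
by move=> [fi fm fj ft fb]; elim: a => //= a IHa b IHb; rewrite ?fi ?fm ?fj IHa IHb.
Qed.

Lemma eval_subst (A : algebra s) V W (sigma : V -> form s W) (v : W -> A) a :
  eval v (subst sigma a) = eval (fun x => eval v (sigma x)) a.
Proof. by elim: a => //= a -> b ->. Qed.

Lemma substE V W (sigma : V -> form s W) a :
  subst sigma a = eval (A := form_algebra W) sigma a.
Proof. by elim: a => //= a -> b ->. Qed.

Lemma subst_hom V W (sigma : V -> form s W) :
  hom (A := form_algebra V) (B := form_algebra W) (subst sigma).
Proof. by split. Qed.

Lemma hom_form (B : algebra s) V (f : form_algebra V -> B) a :
  hom f -> f a = eval (fun x => f (Var x)) a.
Proof.
by move=> [fi fm fj ft fb]; elim: a => //= a IHa b IHb;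
  rewrite -?IHa -?IHb -?fi -?fm -?fj.
Qed.

(** For each set of premises, the least deductive set of formulas containing
    it, leastness being expressed by soundness in all filters of all algebras.
    Intuitionistic logic and its negation-less fragment are both of this kind. *)
Record base_logic (L : logic s) : Prop := BaseLogic {
  base_hyp : forall V (Gamma : set (form s V)), Gamma `<=` L V Gamma;
  base_deductive : forall V (Gamma : set (form s V)),
    deductive (A := form_algebra V) (L V Gamma);
  base_sound : forall V (Gamma : set (form s V)) a (A : algebra s)
    (D : A -> Prop) (v : V -> A), deductive D -> L V Gamma a ->
    (forall g, Gamma g -> D (eval v g)) -> D (eval v a) }.

End Formulas.

Section Beth.
Variables (s : signature) (L0 L : logic s) (Ax : set (form s nat)).
Hypothesis base : base_logic L0.
Hypothesis LE : forall V (Gamma : set (form s V)) a,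
  L Gamma a <-> extend L0 Ax Gamma a.
Hypothesis L_prelinear : L set0 (prelinearity s).

Definition model (A : algebra s) : Prop :=
  bounded_brouwerian A /\
  forall (v : nat -> A) c, Ax c -> eval v c = top A.

Lemma logic_deductive V (Gamma : set (form s V)) :
  deductive (A := form_algebra s V) (L Gamma).
Proof.
suff -> : L Gamma = extend L0 Ax Gamma by exact: base_deductive base _ _.
by apply/predeqP => a; exact: LE.
Qed.

Lemma logic_hyp V (Gamma : set (form s V)) a : Gamma a -> L Gamma a.
Proof. by move=> Ga; apply/LE; apply: (base_hyp base); left. Qed.

Lemma logic_sound V (Gamma : set (form s V)) a (A : algebra s) (v : V -> A) :
  model A -> L Gamma a -> (forall g, Gamma g -> eval v g = top A) ->
  eval v a = top A.
Proof.
move=> [bA AxA] /LE La Gv.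
apply: (base_sound base (deductive_top bA) La) => g [/Gv//|].
by move=> [sigma [c [Axc ->]]]; rewrite eval_subst AxA.
Qed.

Lemma model_prelinear A : model A -> prelinear_brouwerian A.
Proof.
move=> mA; split=> [|x y]; first by case: mA.
exact: (logic_sound (v := fun n => if n is 0 then x else y) mA L_prelinear).
Qed.

(** Covers both the Lindenbaum-Tarski algebra, whose filter contains the
    substitution instances of the axioms, and the quotients of a model, in which
    the axioms take the value top before passing to the quotient. *)
Lemma quotient_model (A : algebra s) (D : A -> Prop) :
  deductive D -> (forall (v : nat -> A) c, Ax c -> D (eval v c)) ->
  model (quotient D).
Proof.
move=> dD AxD; split; first exact: quotient_brouwerian.
move=> v c Axc.
have -> : v = proj D \o (fun n => repr (v n)).
  by apply: funext => n; rewrite /= [proj _ _]class_repr.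
rewrite -eval_hom; last exact: proj_hom.
by apply/proj_top => //; exact: AxD.
Qed.

(** The additional variables are the elements of the target [C] of two
    homomorphisms [f, g] that agree on X. The substitution replaces z by the
    variable [g z], so that a formula and its substitution instance take under
    [v] the values given by [f] and by [g]. *)
Lemma logic_infinite_beth : infinite_beth L.
Proof.
move=> X Z Gamma implicit.
have dL := @logic_deductive _ Gamma.
pose B := quotient (A := form_algebra s (X + Z)) (L Gamma).
pose pi : form_algebra s (X + Z) -> B := proj _.
have hom_pi : hom pi by exact: proj_hom.
pose h : form_algebra s X -> B := pi \o rename inl.
have mB : model B.
  apply: quotient_model => // v c Axc; rewrite -substE; apply/LE.
  by apply: (base_hyp base); right; exists v, c.
have onto : surjective h.
  apply: (epi_surjective model_prelinear) mB _ _.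
  - move=> A D mA dD; apply: quotient_model => // v c Axc.
    by case: mA => _ /(_ v c Axc) ->; exact: ded_top.
  - by apply: hom_comp => //; exact: subst_hom.
  move=> C f g mC hom_f hom_g fg.
  have bC := mC.1.
  have fgX x : f (pi (Var (inl x))) = g (pi (Var (inl x))) by exact: (fg (Var x)).
  have top_pi a : Gamma a -> pi a = top B.
    by move=> Ga; apply/proj_top => //; exact: logic_hyp.
  pose v (w : X + Z + C) : C := match w with inl u => f (pi (Var u)) | inr c => c end.
  pose sigma (w : X + Z + C) : form s (X + Z + C) :=
    match w with inl (inr z) => Var (inr (g (pi (Var (inr z))))) | _ => Var w end.
  have evl (k : B -> C) a : hom k -> Gamma a -> eval (k \o pi \o Var) a = top C.
    move=> hom_k Ga; have [_ _ _ kt _] := hom_k.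
    rewrite -(hom_form (f := k \o pi)); last exact: hom_comp.
    by rewrite /= top_pi.
  pose Gamma' : set (form s (X + Z + C)) := rename inl @` Gamma.
  have premises a : (Gamma' `|` subst sigma @` Gamma') a -> eval v a = top C.
    move=> [[c Gc <-]|[_ [c Gc <-] <-]]; rewrite !eval_subst.
      exact: (evl f).
    rewrite -(evl g c) //; congr eval.
    by apply: funext => -[x|z] /=.
  have fgZ z : f (pi (Var (inr z))) = g (pi (Var (inr z))).
    have := implicit C sigma (fun x => erefl) z.
    move=> /(logic_sound (v := v) mC)/(_ premises) /= eq_top.
    have dT := deductive_top bC.
    apply: (le_anti bC); apply/(imp_topE bC).
      exact: (ded_mp dT) (ded_meetl dT _ _) eq_top.
    exact: (ded_mp dT) (ded_meetr dT _ _) eq_top.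
  move=> q; have [a <-] := proj_surjective q.
  have [hfp hgp] := (hom_comp hom_f hom_pi, hom_comp hom_g hom_pi).
  rewrite -[f _]/((f \o pi) a) -[g _]/((g \o pi) a) (hom_form _ hfp) (hom_form _ hgp).
  by congr eval; apply: funext => -[x|z] /=.
move=> z; have [phi /esym/(proj_eq dL)[zp pz]] := onto (pi (Var (inr z))).
exists phi; exact: (meet_mem dL zp pz).
Qed.

End Beth.

Lemma int_logic_base : base_logic int_logic.
Proof.
split=> [V Gamma a|V Gamma|V Gamma a A D v dD]; first exact: IntHyp.
  split; try by [constructor | exact: IntMP].
  by move=> b x; rewrite (bool_irrelevance b isT); exact: IntBot.
elim=> {a} /= [a Ga|a b _ IHab _ IHa||||||||||] *.
- by auto.
- by apply: (ded_mp dD) (IHab _) (IHa _).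
- exact: ded_K.
- exact: ded_S.
- exact: ded_meetl.
- exact: ded_meetr.
- exact: ded_meet.
- exact: ded_joinl.
- exact: ded_joinr.
- exact: ded_join.
- exact: ded_top.
- exact: ded_bot.
Qed.

(** [None] is the new least element. *)
Definition add_bot (A : algebra PositiveSig) : algebra FullSig :=
  @Algebra FullSig (option A)
    (fun x y => match x, y with
                | Some a, Some b => Some (imp a b)
                | Some _, None => None
                | None, _ => Some (top A)
                end)
    (fun x y => match x, y with Some a, Some b => Some (meet a b) | _, _ => None end)
    (fun x y => match x, y with
                | Some a, Some b => Some (join a b)
                | Some _, None => x
                | None, _ => y
                end)
    (Some (top A)) (fun=> None).

Definition some_in (A : algebra PositiveSig) (D : A -> Prop) (x : add_bot A) : Prop :=
  if x is Some a then D a else False.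

(** Conservativity of intuitionistic logic over its negation-less axioms, in
    algebraic form: adjoining a bottom preserves the validity of these, for
    filters that do not contain it. *)
Lemma some_in_deductive (A : algebra PositiveSig) (D : A -> Prop) :
  deductive D -> deductive (some_in D).
Proof.
move=> dD.
have dT := ded_top dD; have wk := ent_weak dD; have rf := ent_refl dD.
have dK := ded_K dD.
split=> //.
- by move=> [x|] [y|] //=; exact: ded_mp.
- by move=> [x|] [y|] //=; auto; exact: ded_K.
- by move=> [x|] [y|] [z|] //=; auto; exact: ded_S.
- by move=> [x|] [y|] //=; auto; exact: ded_meetl.
- by move=> [x|] [y|] //=; auto; exact: ded_meetr.
- by move=> [x|] [y|] //=; auto; exact: ded_meet.
- by move=> [x|] [y|] //=; auto; exact: ded_joinl.
- by move=> [x|] [y|] //=; auto; exact: ded_joinr.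
- by move=> [x|] [y|] [z|] //=; auto; exact: ded_join.
Qed.

Lemma eval_embed (A : algebra PositiveSig) V (v : V -> A) a :
  eval (A := add_bot A) (fun x => Some (v x)) (embed a) = Some (eval v a).
Proof. by elim: a => //= a -> b ->. Qed.

Lemma pos_int_logic_base : base_logic pos_int_logic.
Proof.
split=> [V Gamma a Ga|V Gamma|V Gamma a A D v dD prov Gv].
- by apply: IntHyp; exists a.
- split=> //.
  + by move=> x y; exact: IntMP.
  + by move=> x y; exact: IntK.
  + by move=> x y z; exact: IntS.
  + by move=> x y; exact: IntAndL.
  + by move=> x y; exact: IntAndR.
  + by move=> x y; exact: IntAnd.
  + by move=> x y; exact: IntOrL.
  + by move=> x y; exact: IntOrR.
  + by move=> x y z; exact: IntOr.
  + exact: IntTop.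
- suff: some_in D (eval (A := add_bot A) (fun x => Some (v x)) (embed a)) by rewrite eval_embed.
  apply: (base_sound int_logic_base (some_in_deductive dD) prov) => _ [g Gg <-].
  by rewrite eval_embed; exact: Gv.
Qed.

Theorem corollary5p7 :
  (forall K : algebra FullSig -> Prop,
     variety K -> (forall A : algebra FullSig, K A -> godel_algebra A) ->
     epimorphisms_surjective K) /\
  (forall K : algebra PositiveSig -> Prop,
     variety K -> (forall A : algebra PositiveSig, K A -> relative_stone_algebra A) ->
     epimorphisms_surjective K) /\
  (forall L : logic FullSig, godel_logic L -> infinite_beth L) /\
  (forall L : logic PositiveSig, positive_godel_logic L -> infinite_beth L).
Proof.
split; [|split; [|split]].
- move=> K vK KG; apply: variety_epimorphisms_surjective => // A /KG.
  move=> [I [C [e [PC he ie se]]]]; apply: subdirect_prelinear.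
  exists I, C, e; split=> // i; have [[bC botC] totC] := PC i.
  by split=> //; split=> // b x; rewrite (bool_irrelevance b isT).
- move=> K vK KG; apply: variety_epimorphisms_surjective => // A /KG.
  move=> [I [C [e [PC he ie se]]]]; apply: subdirect_prelinear.
  by exists I, C, e; split=> // i; have [bC totC] := PC i.
- move=> L [[Ax LE] Lpl]; exact: logic_infinite_beth int_logic_base LE Lpl.
- move=> L [[Ax LE] Lpl]; exact: logic_infinite_beth pos_int_logic_base LE Lpl.
Qed.
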